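(* Let $G$ be a graph with simplexes $H_1,\ldots,H_r$ such that $\{V(H_i)\}_{i=1}^r$ is a partition of $V(G)$. If $G$ has no isolated vertices, then there is $D=\{y_1,\ldots,y_k\}\in\mathcal{A}_G$, and there are simplicial vertices $x_1,\ldots,x_k$ of $G$ and integers $1\leq j_1<\cdots<j_k\leq r$ such that $P=\{\{x_i,y_i\}\}_{i=1}^k$ is an induced matching of $G$ and $H_{j_i}$ is the induced subgraph $G[N_G[x_i]]$ on $N_G[x_i]$ for $i=1,\ldots,k$. Furthermore, $${\rm v}(I(G))\leq|D|=|P|\leq{\rm im}(G)\leq{\rm reg}(S/I(G)).$$
   Context: Graphs are finite and simple. Let $G$ be a graph with vertex set $V(G)=\{t_1,\ldots,t_s\}$ and edge set $E(G)$, let $K$ be a field and $S=K[t_1,\ldots,t_s]$ with the standard grading $S=\bigoplus_{d\ge0}S_d$. The edge ideal of $G$ is $I(G)=(t_it_j\mid\{t_i,t_j\}\in E(G))\subset S$. For a graded ideal $I\subset S$, ${\rm Ass}(I)$ is the set of associated primes of $S/I$, and the v-number is ${\rm v}(I)=\min\{d\geq 0\mid\exists\, f\in S_d,\ \mathfrak{p}\in{\rm Ass}(I)\text{ with }(I\colon f)=\mathfrak{p}\}$, where $(I\colon f)=\{g\in S\mid gf\in I\}$. ${\rm reg}(S/I)$ is the Castelnuovo–Mumford regularity: $\max\{j-i\mid b_{i,j}\neq0\}$, where $b_{i,j}$ are the graded Betti numbers of the minimal graded free resolution of $S/I$ over $S$. For $v\in V(G)$, $N_G(v)$ is the set of vertices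 adjacent to $v$ and $N_G[v]=N_G(v)\cup\{v\}$; for $A\subset V(G)$, $N_G(A)=\bigcup_{a\in A}N_G(a)$ and $G[A]$ is the induced subgraph on $A$. A vertex $v$ is simplicial if $G[N_G[v]]$ is a complete graph. A subgraph $H$ of $G$ is a simplex if $H=G[N_G[v]]$ for some simplicial vertex $v$. A set $A\subset V(G)$ is stable if no two of its vertices are joined by an edge. A set $C\subset V(G)$ is a vertex cover if every edge is incident with a vertex of $C$; it is minimal if no proper subset is a vertex cover. $\mathcal{A}_G$ is the family of all stable sets $A$ of $G$ such that $N_G(A)$ is a minimal vertex cover of $G$. A matching is a set of pairwise disjoint edges; it is an induced matching of $G$ if the only edges of $G$ contained in the union of its edges are the edges of the matching. ${\rm im}(G)$ is the number of edges in a largest induced matching of $G$. *)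

(* Defs.v *)
From HB Require Import structures.
From mathcomp Require Import all_boot all_order all_algebra.
From mathcomp Require Import mpoly.

Set Implicit Arguments.
Unset Strict Implicit.
Unset Printing Implicit Defensive.

Import GRing.Theory Num.Theory.
Local Open Scope ring_scope.

(** * Graphs on the vertex set [{t_1, ..., t_s}], indexed by ['I_s] *)

Record sgraph (s : nat) := SGraph {
  adj : rel 'I_s;
  adj_sym : ssrbool.symmetric adj;
  adj_irrefl : irreflexive adj }.

Record subgraph (s : nat) := Subgraph {
  vertices : {set 'I_s};
  sedges : {set {set 'I_s}} }.

Section Graph.
Variables (s : nat) (G : sgraph s).
Implicit Types (v : 'I_s) (A C : {set 'I_s}) (P : {set {set 'I_s}}).

Definition edges : {set {set 'I_s}} :=
  [set e | [exists u, exists w, adj G u w && (e == [set u; w])]].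

Definition nbh v : {set 'I_s} := [set w | adj G v w].
Definition cl_nbh v : {set 'I_s} := v |: nbh v.
Definition nbh_set A : {set 'I_s} := \bigcup_(a in A) nbh a.

Definition isolated v : bool := nbh v == set0.

Definition induced A : subgraph s := Subgraph A [set e in edges | e \subset A].

Definition complete (H : subgraph s) : bool :=
  [forall u in vertices H, forall w in vertices H,
    (u != w) ==> ([set u; w] \in sedges H)].

Definition simplicial v : bool := complete (induced (cl_nbh v)).

Definition is_simplex (H : subgraph s) : Prop :=
  exists2 v, simplicial v & H = induced (cl_nbh v).

Definition stable A : bool := [forall u in A, forall w in A, ~~ adj G u w].

Definition vertex_cover C : bool :=
  [forall e in edges, e :&: C != set0].

Definition min_vertex_cover C : bool := minset vertex_cover C.

Definition stable_min_cover : {set {set 'I_s}} :=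
  [set A | stable A && min_vertex_cover (nbh_set A)].

Definition matching P : bool := (P \subset edges) && trivIset P.

Definition induced_matching P : bool :=
  matching P && [forall e in edges, (e \subset cover P) ==> (e \in P)].

Definition im : nat :=
  (\max_(P : {set {set 'I_s}} | induced_matching P) #|P|)%N.

End Graph.

(** * Ideals of [S = K[t_1, ..., t_s]], as [Prop]-valued predicates *)

Section Algebra.
Variables (K : fieldType) (s : nat).
Local Notation S := {mpoly K[s]}.
Implicit Types (I p : S -> Prop) (f g : S).

Definition edge_ideal (G : sgraph s) : S -> Prop := fun f =>
  exists c : 'I_s * 'I_s -> S,
    f = \sum_(e | adj G e.1 e.2) c e * ('X_e.1 * 'X_e.2).

Definition ideal I : Prop :=
  [/\ I 0, forall f g, I f -> I g -> I (f + g) & forall f g, I g -> I (f * g)].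

Definition prime_ideal p : Prop :=
  [/\ ideal p, ~ p 1 & forall f g, p (f * g) -> p f \/ p g].

Definition colon I f : S -> Prop := fun g => I (g * f).

(* [colon I h] is the annihilator of the class of [h] in [S/I]. *)
Definition associated_prime I p : Prop :=
  prime_ideal p /\ exists h, forall g, p g <-> colon I h g.

(* [f \is d.-homog] includes [f = 0], so it says exactly that [f] lies in
   [S_d]. *)
Definition v_attained I (d : nat) : Prop :=
  exists f p, [/\ f \is d.-homog, associated_prime I p
                & forall g, colon I f g <-> p g].

Definition is_vnumber I (v : nat) : Prop :=
  v_attained I v /\ forall d, v_attained I d -> (v <= d)%N.

(* A graded free resolution
     ... -> F_2 -> F_1 -> F_0 -> S/I -> 0
   with [F_i] the direct sum of the [S(- shift i k)], [k < rk i].  Elements of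
   [F_i] are row vectors and maps act by multiplication on the right; the k-th
   row of a matrix is the image of the k-th basis element, which has degree
   [shift i k].  The map [F_0 -> S/I] is given by representatives [aug k 0] in
   [S] of the images of the basis elements. *)
Record graded_resolution I := GradedResolution {
  rk : nat -> nat;
  shift : forall i, 'I_(rk i) -> int;
  diff : forall i, 'M[S]_(rk i.+1, rk i);
  aug : 'cV[S]_(rk 0);
  diff_homog : forall i k l m, m \in msupp (diff i k l) ->
    (mdeg m)%:Z + shift l = shift k;
  aug_homog : forall k m, m \in msupp (aug k 0) -> (mdeg m)%:Z = shift k;
  aug_surj : exists u : 'rV[S]_(rk 0), I ((u *m aug) 0 0 - 1);
  aug_exact : forall u : 'rV[S]_(rk 0),
    I ((u *m aug) 0 0) <-> exists w : 'rV[S]_(rk 1), u = w *m diff 0;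
  diff_exact : forall i (u : 'rV[S]_(rk i.+1)),
    u *m diff i = 0 <-> exists w : 'rV[S]_(rk i.+2), u = w *m diff i.+1 }.

(* The image of [F_(i+1)] is contained in [(t_1, ..., t_s) F_i]. *)
Definition minimal I (F : graded_resolution I) : Prop :=
  forall i k l, (diff F i k l)@_0%MM = 0.

Definition betti I (F : graded_resolution I) (i : nat) (j : int) : nat :=
  #|[set k : 'I_(rk F i) | shift k == j]|.

Definition is_regularity I (r : int) : Prop :=
  exists F : graded_resolution I,
    [/\ minimal F,
        exists (i : nat) (j : int), betti F i j <> 0%N /\ j - i%:Z = r
      & forall (i : nat) (j : int), betti F i j <> 0%N -> j - i%:Z <= r].

End Algebra.

Arguments edge_ideal K {s} G _.

(* Main.v *)
Require Import Defs.
From mathcomp Require Import all_boot all_order all_algebra.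
From mathcomp Require Import mpoly.
From mathcomp Require Import zify ring.
From Stdlib Require Import Classical_Prop.

Set Implicit Arguments.
Unset Strict Implicit.
Unset Printing Implicit Defensive.

(** The sets D and P. Let x_1, ..., x_r be simplicial vertices whose closed
    neighbourhoods are the given simplexes, and let D be a maximal stable set
    among the vertices other than the x_i. Then V \ N(D) is stable: of two
    adjacent vertices at least one is not an x_i, and by maximality it lies in
    D or in N(D) (exists_stable_avoiding). For a stable set D this already
    makes N(D) a minimal vertex cover, since a vertex of N(D) has a neighbour
    in D and D misses N(D) (stable_min_coverP). A simplex is a complete graph,
    so D meets it at most once; the simplexes met by D give the pairs
    {x_i, y_i}. They form an induced matching because all the neighbours of
    x_i lie in its own simplex and the y_i are pairwise non-adjacent
    (induced_simplex_matching).

    The v-number. Multiplying by the product f of the variables in D turns the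
    edge ideal into a prime: a monomial times f lies in I(G) exactly when the
    monomial is divisible by a variable in N(D), so (I(G) : f) is the prime
    generated by N(D) (colon_mset, prime_var_ideal), and f has degree |D|.

    The regularity. An induced matching with edges {a_i, b_i}, i = 1, ..., m,
    gives the Koszul cycle a_1 ... a_m e_{b_1} /\ ... /\ e_{b_m} with
    coefficients in S/I(G), of homological degree m and internal degree 2m. It
    is not a boundary: the sum, over the transversals T of the matching, of
    the coefficient of the complementary squarefree monomial in front of e_T
    vanishes on all boundaries, since the terms cancel in pairs when a_i and
    b_i are exchanged, and it vanishes on I(G), since complements of
    transversals are stable; on the cycle it is 1 (transversal_sum_koszul,
    transversal_sum_ideal, matching_cycle_not_boundary). This is a nonzero
    class in Tor_m(S/I(G), K) of degree 2m.

    A minimal resolution F computes the same Tor. The comparison is carried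
    out by hand, as a zigzag in the double complex of F and the Koszul complex
    of the variables: lift a chain along F, take its Koszul boundary, lift
    again, and so on (obstruction_lift). The Koszul complex with coefficients
    in S is exact up to constants (koszul_exact), so the obstruction survives
    each step unless some lift has a nonzero constant coefficient; this must
    happen within m steps, because the exterior degree drops each time. By
    homogeneity that coefficient sits at a generator of F_i of degree 2m with
    i <= m, hence m <= 2m - i <= reg (koszul_cycle_betti,
    induced_matching_regularity). *)

(** * Supports and homogeneous components of polynomials *)

Section PolynomialSupport.

Import GRing.Theory.
Local Open Scope ring_scope.

Variables (K : fieldType) (n : nat).
Local Notation S := {mpoly K[n]}.
Implicit Types (p q : S) (m a : 'X_{1..n}) (A : {set 'I_n}).

Lemma mcoeffXM a p m :
  ('X_[a] * p)@_m = if (a <= m)%MM then p@_(m - a) else 0.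
Proof.
rewrite mulrC; case: ifP => [le_am|/negP not_le].
  by rewrite -{1}(submK le_am) addmC mcoeffMX.
apply/memN_msupp_eq0/negP => m_in; apply: not_le.
move: m_in; rewrite (perm_mem (msuppMX p a)) => /mapP[m' _ ->].
by apply/mnm_lepP => i; rewrite mnmDE leq_addr.
Qed.

Lemma mnm1_le i m : (U_(i) <= m)%MM = (0 < m i)%N.
Proof.
apply/mnm_lepP/idP => [/(_ i)|mi j]; rewrite mnm1E ?eqxx //.
by case: eqP => // <-.
Qed.

Lemma mcoeff_sum (I : Type) (r : seq I) (P : pred I) (F : I -> S) m :
  (\sum_(i <- r | P i) F i)@_m = \sum_(i <- r | P i) (F i)@_m.
Proof. exact: raddf_sum. Qed.

Definition mfilter (P : pred 'X_{1..n}) p : S :=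
  \sum_(m <- msupp p | P m) p@_m *: 'X_[m].

Lemma mcoeff_mfilter P p m : (mfilter P p)@_m = if P m then p@_m else 0.
Proof.
rewrite /mfilter raddf_sum /=.
have [m_in|m_notin] := boolP (m \in msupp p); last first.
  rewrite (memN_msupp_eq0 m_notin) if_same big_seq_cond big1 // => m' /andP[m'_in _].
  rewrite mcoeffZ mcoeffX; case: eqP => [eq_m|_]; last by rewrite mulr0.
  by rewrite -eq_m m'_in in m_notin.
rewrite -big_filter; case: ifP => Pm.
  rewrite (bigD1_seq m) ?filter_uniq ?msupp_uniq ?mem_filter ?Pm //=.
  rewrite mcoeffZ mcoeffX eqxx mulr1 big1 ?addr0 // => m' /negbTE ne.
  by rewrite mcoeffZ mcoeffX ne mulr0.
rewrite big_seq big1 // => m'; rewrite mem_filter => /andP[Pm' _].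
rewrite mcoeffZ mcoeffX; case: eqP => [eq_m|_]; last by rewrite mulr0.
by rewrite -eq_m Pm' in Pm.
Qed.

(** The quotient of [p] by the variable [i], the monomials free of [i] being
    dropped. *)
Definition mquot (i : 'I_n) p : S :=
  \sum_(m <- msupp p | (0 < m i)%N) p@_m *: 'X_[m - U_(i)].

Lemma mcoeff_mquot i p m : (mquot i p)@_m = p@_(m + U_(i)).
Proof.
have quotK : 'X_i * mquot i p = mfilter (fun m' => (0 < m' i)%N) p.
  rewrite /mquot /mfilter mulr_sumr; apply: eq_bigr => m' m'i.
  by rewrite -scalerAr -mpolyXD addmC submK // mnm1_le.
move/(congr1 (mcoeff (m + U_(i))%MM)): quotK.
rewrite mcoeffXM mnm1_le mcoeff_mfilter mnmDE mnm1E eqxx addn1 /=.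
by rewrite addmK.
Qed.

(** The exponent is an integer because the twists of a graded free module
    may be negative. *)
Definition homogeneous (d : int) p : Prop :=
  forall m, p@_m != 0 -> (mdeg m)%:Z = d.

Lemma homogeneous0 d : homogeneous d 0.
Proof. by move=> m; rewrite mcoeff0 eqxx. Qed.

Lemma homogeneousD d p q :
  homogeneous d p -> homogeneous d q -> homogeneous d (p + q).
Proof.
move=> hp hq m; rewrite mcoeffD.
by have [->|/hp //] := eqVneq p@_m 0; rewrite add0r; apply: hq.
Qed.

Lemma homogeneous_sum d (I : Type) (r : seq I) (P : pred I) (F : I -> S) :
  (forall i, P i -> homogeneous d (F i)) ->
  homogeneous d (\sum_(i <- r | P i) F i).
Proof.
move=> hF; elim/big_rec: _ => [|i p Pi hp]; first exact: homogeneous0.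
by apply: homogeneousD => //; apply: hF.
Qed.

Lemma mcoeffM_neq0 p q m :
  (p * q)@_m != 0 -> exists a b, [/\ m = (a + b)%MM, p@_a != 0 & q@_b != 0].
Proof.
move=> nz; have: m \in msupp (p * q) by rewrite mcoeff_msupp.
move/msuppM_le => /allpairsP[[a b] /= [a_in b_in ->]].
by exists a, b; rewrite -!mcoeff_msupp.
Qed.

Lemma homogeneousM d e p q :
  homogeneous d p -> homogeneous e q -> homogeneous (d + e) (p * q).
Proof.
move=> hp hq m /mcoeffM_neq0[a [b [-> /hp da /hq db]]].
by rewrite mdegD PoszD da db.
Qed.

Lemma homogeneousX m : homogeneous (mdeg m) 'X_[m].
Proof. by move=> m'; rewrite mcoeffX; case: (m =P m') => [->|_]; rewrite ?eqxx. Qed.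

Definition hcomp (d : int) p : S := mfilter (fun m => (mdeg m)%:Z == d) p.

Lemma homogeneous_hcomp d p : homogeneous d (hcomp d p).
Proof. by move=> m; rewrite mcoeff_mfilter; case: ifP => [/eqP|]; rewrite ?eqxx. Qed.

Lemma hcomp_id d p : homogeneous d p -> hcomp d p = p.
Proof.
move=> hp; apply/mpolyP => m; rewrite mcoeff_mfilter; case: ifP => // /eqP ne.
by apply/esym/eqP/negPn/negP => /hp.
Qed.

Lemma hcompB d p q : hcomp d (p - q) = hcomp d p - hcomp d q.
Proof.
apply/mpolyP => m; rewrite mcoeffB !mcoeff_mfilter mcoeffB.
by case: ifP; rewrite ?subr0.
Qed.

Lemma hcomp_sum d (I : Type) (r : seq I) (F : I -> S) :
  hcomp d (\sum_(i <- r) F i) = \sum_(i <- r) hcomp d (F i).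
Proof.
apply/mpolyP => m; rewrite mcoeff_mfilter !mcoeff_sum.
case: ifP => Pm; last first.
  by rewrite big1 // => i _; rewrite mcoeff_mfilter Pm.
by apply: eq_bigr => i _; rewrite mcoeff_mfilter Pm.
Qed.

(** Taking components commutes with multiplication by a homogeneous factor;
    this is what makes the lifts along a graded resolution homogeneous. *)
Lemma hcompM d e p q : homogeneous e q -> hcomp d (p * q) = hcomp (d - e) p * q.
Proof.
move=> hq; apply/mpolyP => m; rewrite mcoeff_mfilter mcoeffM.
rewrite [RHS]mcoeffM; case: ifP => [/eqP dm|/eqP dm]; last first.
  apply/esym/big1 => -[a b] /= /eqP def_m; rewrite mcoeff_mfilter.
  case: eqP => [da|_]; last by rewrite mul0r.
  have [->|/hq db] := eqVneq (q@_b) 0; first by rewrite mulr0.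
  by case: dm; have := congr1 (@mdeg n) def_m; rewrite mdegD; lia.
apply: eq_bigr => -[a b] /= /eqP def_m; rewrite mcoeff_mfilter.
have [->|/hq db] := eqVneq (q@_b) 0; first by rewrite !mulr0.
case: eqP => // da; case: da.
by have := congr1 (@mdeg n) def_m; rewrite mdegD; lia.
Qed.

(** The exponent of the squarefree monomial with support [A]. *)
Definition mset A : 'X_{1..n} := [multinom (i \in A : nat) | i < n].

Lemma msetE A i : mset A i = (i \in A).
Proof. exact: mnmE. Qed.

Lemma mdeg_mset A : mdeg (mset A) = #|A|.
Proof.
by rewrite mdegE (eq_bigr (fun i => (i \in A : nat))) => [|i _];
   rewrite ?msetE // -sum1_card [RHS]big_mkcond.
Qed.

Lemma mset_D1 A i : i \in A -> (mset A - U_(i))%MM = mset (A :\ i).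
Proof.
move=> iA; apply/mnmP => j; rewrite mnmBE !msetE mnm1E !inE (eq_sym i).
by case: eqP => [->|_]; rewrite ?iA ?subn0.
Qed.

End PolynomialSupport.

(** * The Koszul complex of the variables *)

Section Koszul.

Import GRing.Theory.
Local Open Scope ring_scope.

Variables (K : fieldType) (n : nat) (lt : rel 'I_n).
Local Notation S := {mpoly K[n]}.
(* The signs only compare pairs of indices, so an arbitrary tournament can
   replace the order of the variables. *)
Hypothesis lt_asym : forall i j, i != j -> lt i j = ~~ lt j i.
Implicit Types (T : {set 'I_n}) (c v : {set 'I_n} -> S).

Definition ksign (j : 'I_n) T : S := (-1) ^+ #|[set i in T | lt i j]|.

Lemma ksignU1 j k T :
  k \notin T -> ksign j (k |: T) = (-1) ^+ lt k j * ksign j T.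
Proof.
move=> kT; rewrite /ksign -exprD; congr (@GRing.exp S (-1) _).
have [ltkj|ltkj] := boolP (lt k j).
  rewrite -(_ : k |: [set i in T | lt i j] = [set i in k |: T | lt i j]).
    by rewrite cardsU1 inE (negbTE kT).
  by apply/setP => i; rewrite !inE; case: eqP => // ->; rewrite ltkj.
rewrite add0n; apply: eq_card => i; rewrite !inE.
by case: (eqVneq i k) => [->|]; rewrite ?(negbTE ltkj) ?andbF.
Qed.

(** The sign rule behind both the vanishing of the squared differential and
    the homotopy formula. *)
Lemma ksign_swap j k T : j != k -> j \notin T -> k \notin T ->
  ksign j (k |: T) * ksign k T = - (ksign k (j |: T) * ksign j T).
Proof.
move=> jk jT kT; rewrite !ksignU1 // (lt_asym jk).
by case: (lt k j); rewrite /= ?expr1 ?expr0; ring.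
Qed.

Lemma ksignK j T : ksign j T * ksign j T = 1.
Proof. by rewrite /ksign -exprD addnn -mul2n exprM sqrrN !expr1n. Qed.

(** The Koszul differential of the variables: [c T] is the coefficient of the
    exterior monomial with support [T]. *)
Definition koszul c T : S :=
  \sum_(j | j \notin T) ksign j T * ('X_j * c (j |: T)).

Lemma eq_koszul c v : c =1 v -> koszul c =1 koszul v.
Proof. by move=> eq_cv T; apply: eq_bigr => j _; rewrite eq_cv. Qed.

Lemma koszulD c v T : koszul (fun U => c U + v U) T = koszul c T + koszul v T.
Proof. by rewrite -big_split; apply: eq_bigr => j _; rewrite /= !mulrDr. Qed.

Lemma koszulB c v T : koszul (fun U => c U - v U) T = koszul c T - koszul v T.
Proof. by rewrite -sumrB; apply: eq_bigr => j _; rewrite /= !mulrBr. Qed.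

Lemma koszul_sumM (I : Type) (r : seq I) (c : I -> {set 'I_n} -> S)
    (a : I -> S) T :
  koszul (fun U => \sum_(i <- r) c i U * a i) T
    = \sum_(i <- r) koszul (c i) T * a i.
Proof.
under [RHS]eq_bigr => i _ do rewrite big_distrl.
rewrite exchange_big; apply: eq_bigr => j _ /=.
rewrite mulr_sumr mulr_sumr; apply: eq_bigr => i _.
by rewrite !mulrA.
Qed.

(** The terms cancel in pairs [(j, k)], [(k, j)]; they are matched
    explicitly, since antisymmetry is not enough in characteristic 2. *)
Lemma koszul_koszul c T : koszul (koszul c) T = 0.
Proof.
pose f j k := ksign j T * ('X_j * (ksign k (j |: T) *
                ('X_k * c (k |: (j |: T))))).
transitivity (\sum_(j | j \notin T) (\sum_(k | (k \notin T) && (k != j)) f j k)).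
  apply: eq_bigr => j jT; rewrite /koszul !mulr_sumr.
  by apply: eq_bigl => k; rewrite !inE negb_or andbC.
pose g j k : S := if (j \notin T) && (k \notin T) && (k != j) then f j k else 0.
have gN j k : g j k = - g k j.
  rewrite /g [(k \notin T) && _]andbC (eq_sym j k).
  case: ifP => [/andP[/andP[jT kT]]|_]; last by rewrite oppr0.
  rewrite eq_sym => jk.
  rewrite /f setUCA; have := ksign_swap jk jT kT.
  set a := ksign _ _; set b := ksign _ _; set c' := ksign _ _; set d := ksign _ _.
  set C := c _ => e.
  transitivity ((c' * d) * ('X_j * 'X_k * C)); first by ring.
  transitivity (- (a * b) * ('X_j * 'X_k * C)); last by ring.
  by rewrite e opprK.
have gjj j : g j j = 0 by rewrite /g eqxx andbF.
transitivity (\sum_j \sum_k g j k).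
  rewrite big_mkcond; apply: eq_bigr => j _; rewrite /g; case: ifP => _ /=.
    by rewrite big_mkcond.
  by rewrite big1.
transitivity (\sum_(j : 'I_n) \sum_(k : 'I_n | (k < j)%N) g j k
              + \sum_(j : 'I_n) \sum_(k : 'I_n | (j < k)%N) g j k).
  rewrite -big_split; apply: eq_bigr => j _ /=.
  rewrite (bigID (fun k : 'I_n => (k < j)%N)) /=; congr (_ + _).
  rewrite (bigD1 j) ?ltnn //= gjj add0r; apply: eq_bigl => k.
  by rewrite -leqNgt ltn_neqAle andbC eq_sym.
rewrite [X in _ + X](exchange_big_dep xpredT) //= -big_split big1 // => j _ /=.
by rewrite -big_split big1 // => k _; rewrite /= gN addNr.
Qed.

(** Contraction of the Koszul complex in the direction of the variable [k]:
    wedge with [k] and divide the coefficient by ['X_k]. *)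
Definition contract (k : 'I_n) c T : S :=
  if k \in T then ksign k (T :\ k) * mquot k (c (T :\ k)) else 0.

Lemma mquot_sum (I : Type) (r : seq I) (P : pred I) (F : I -> S) k :
  mquot k (\sum_(i <- r | P i) F i) = \sum_(i <- r | P i) mquot k (F i).
Proof.
apply/mpolyP => m; rewrite mcoeff_mquot !mcoeff_sum.
by apply: eq_bigr => i _; rewrite mcoeff_mquot.
Qed.

Lemma mquotD k (p q : S) : mquot k (p + q) = mquot k p + mquot k q.
Proof. by apply/mpolyP => m; rewrite mcoeffD !mcoeff_mquot mcoeffD. Qed.

Lemma mquot_sign k j T (p : S) : mquot k (ksign j T * p) = ksign j T * mquot k p.
Proof.
have signE (q : S) : ksign j T * q = ((-1) ^+ #|[set i in T | lt i j]|)%:MP * q.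
  by rewrite rmorph_sign.
by apply/mpolyP => m; rewrite mcoeff_mquot !signE !mcoeffCM mcoeff_mquot.
Qed.

Lemma mquotXK k (p : S) : mquot k ('X_k * p) = p.
Proof.
by apply/mpolyP => m; rewrite mcoeff_mquot addmC mulrC mcoeffMX.
Qed.

Lemma mquotX k j (p : S) : j != k -> mquot k ('X_j * p) = 'X_j * mquot k p.
Proof.
move=> jk; apply/mpolyP => m; rewrite mcoeff_mquot !mcoeffXM !mnm1_le.
rewrite mnmDE mnm1E eq_sym (negbTE jk) addn0; case: ifP => // mj.
rewrite mcoeff_mquot; congr (_@__); apply/mnmP => i.
rewrite !(mnmDE, mnmBE) !mnm1E; case: (eqVneq j i) => [<-|_]; last by rewrite !subn0.
by rewrite eq_sym (negbTE jk) !addn0.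
Qed.

Lemma mulX_mquot k (p : S) :
  'X_k * mquot k p = p - mfilter (fun m => m k == 0%N) p.
Proof.
apply/mpolyP => m; rewrite mcoeffXM mcoeffB mcoeff_mfilter mnm1_le lt0n.
case: eqP => /= [_|/eqP mk]; first by rewrite subrr.
by rewrite mcoeff_mquot submK ?subr0 // mnm1_le lt0n.
Qed.

(** [contract k] is a homotopy between the identity and the restriction to
    the chains that do not involve the variable [k]. *)
Lemma koszul_contract k c T :
  koszul (contract k c) T + contract k (koszul c) T
    = c T - (if k \in T then 0 else mfilter (fun m => m k == 0%N) (c T)).
Proof.
rewrite {2}/contract; case: ifPn => kT; last first.
  rewrite addr0 /koszul (bigD1 k) //= [X in _ + X]big1 => [|j /andP[jT jk]].
    rewrite addr0 /contract setU11 setU1K // -mulX_mquot.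
    transitivity ((ksign k T * ksign k T) * ('X_k * mquot k (c T))); first by ring.
    by rewrite ksignK mul1r.
  by rewrite /contract !inE (negbTE kT) eq_sym (negbTE jk) !mulr0.
have -> : koszul c (T :\ k) = ksign k (T :\ k) * ('X_k * c T) +
    \sum_(j | j \notin T) ksign j (T :\ k) * ('X_j * c (j |: T :\ k)).
  rewrite /koszul (bigD1 k) ?setD11 //= setD1K //; congr (_ + _).
  apply: eq_bigl => j; rewrite !inE.
  by case: (eqVneq j k) => [->|_]; rewrite ?kT ?andbF ?andbT.
rewrite subr0 mquotD mquot_sign mquotXK mulrDr mulrA ksignK mul1r addrCA.
rewrite mquot_sum mulr_sumr.
rewrite -big_split big1 ?addr0 // => j jT /=.
have jk : j != k by apply: contraNneq jT => ->.
have jTk : j \notin T :\ k by rewrite !inE (negbTE jT) andbF.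
rewrite /contract setU1r // mquot_sign mquotX //.
have -> : (j |: T) :\ k = j |: T :\ k.
  apply/setP => i; rewrite !inE; case: (eqVneq i k) => // ->.
  by rewrite eq_sym (negbTE jk).
have := ksign_swap jk jTk (negbT (setD11 k T)); rewrite setD1K //.
have := ksignK k (j |: T :\ k); have := ksignK k (T :\ k).
set a := ksign j T; set b := ksign k (T :\ k); set d := ksign k (_ |: _).
set e := ksign j (T :\ k).
set q := mquot _ _ => bb dd def_ab.
transitivity ((a * d * (b * b) + b * e * (d * d)) * ('X_j * q)).
  by rewrite bb dd; ring.
transitivity ((a * b + d * e) * (b * d * ('X_j * q))); first by ring.
by rewrite def_ab addNr mul0r.
Qed.

(** Exactness: contracting the variables one after the other replaces a cycle
    by its component in the constants, which is the only homology. *)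
Lemma koszul_exact c :
  (forall T, koszul c T = 0) -> (c set0)@_0 = 0 ->
  exists v, forall T, c T = koszul v T.
Proof.
move=> cycle_c c00.
have [v def_v] : exists v, forall T m, (c T - koszul v T)@_m =
    if all (fun k => (k \notin T) && (m k == 0%N)) (enum 'I_n)
    then (c T)@_m else 0.
  elim: (enum 'I_n) c cycle_c {c00} => [|k ks IHks] c cycle_c.
    exists (fun _ => 0) => T m; rewrite /koszul big1 ?subr0 // => j _.
    by rewrite !mulr0.
  pose c1 T := c T - koszul (contract k c) T.
  have c1E T : c1 T = if k \in T then 0 else mfilter (fun m => m k == 0%N) (c T).
    have := koszul_contract k c T; rewrite [X in _ + X]/contract cycle_c.
    have -> : mquot k 0 = 0 :> S.
      by apply/mpolyP => m; rewrite mcoeff_mquot !mcoeff0.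
    by rewrite mulr0 if_same addr0 /c1 => ->; rewrite opprB addrCA subrr addr0.
  have [|v1 def_v1] := IHks c1.
    by move=> T; rewrite koszulB cycle_c koszul_koszul subr0.
  exists (fun T => contract k c T + v1 T) => T m.
  rewrite koszulD opprD addrA def_v1 c1E /=.
  case: (k \in T) => /=; first by rewrite mcoeff0 if_same.
  by rewrite mcoeff_mfilter; case: (m k == 0%N) => //=; rewrite if_same.
exists v => T; apply/eqP; rewrite -subr_eq0; apply/eqP/mpolyP => m.
rewrite def_v mcoeff0; case: allP => // all0.
suff [-> ->] : T = set0 /\ m = 0%MM by [].
split.
  apply/setP => k; rewrite inE; apply/negbTE.
  by case/andP: (all0 k (mem_enum _ k)).
by apply/mnmP => k; rewrite mnm0E; apply/eqP; case/andP: (all0 k (mem_enum _ k)).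
Qed.

End Koszul.

(** * Edge ideals as monomial ideals, and the v-number *)

Section MonomialIdeals.

Import GRing.Theory.
Local Open Scope ring_scope.

Variables (K : fieldType) (n : nat) (G : sgraph n).
Local Notation S := {mpoly K[n]}.
Local Notation I := (edge_ideal K G).
Implicit Types (f g : S) (m : 'X_{1..n}) (C D : {set 'I_n}).

Lemma edge_idealD f g : I f -> I g -> I (f + g).
Proof.
move=> [c ->] [d ->]; exists (fun e => c e + d e).
by rewrite -big_split; apply: eq_bigr => e _; rewrite mulrDl.
Qed.

Lemma edge_idealM f g : I g -> I (f * g).
Proof.
move=> [c ->]; exists (fun e => f * c e).
by rewrite mulr_sumr; apply: eq_bigr => e _; rewrite mulrA.
Qed.

Lemma edge_ideal0 : I 0.
Proof. by exists (fun _ => 0); rewrite big1 // => e _; rewrite mul0r. Qed.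

Definition in_edge m : bool :=
  [exists u, exists v, [&& adj G u v, (0 < m u)%N & (0 < m v)%N]].

Lemma in_edgeP m :
  reflect (exists u v, [/\ adj G u v, (0 < m u)%N & (0 < m v)%N]) (in_edge m).
Proof.
apply: (iffP existsP) => [[u /existsP[v /and3P[]]]|[u [v [uv mu mv]]]].
  by exists u, v.
by exists u; apply/existsP; exists v; apply/and3P.
Qed.

Lemma no_loop u : adj G u u = false.
Proof. exact: adj_irrefl. Qed.

(** The edge ideal is spanned by the monomials divisible by an edge. *)
Lemma edge_idealP f : I f <-> (forall m, f@_m != 0 -> in_edge m).
Proof.
split=> [[c ->] m|supp_f].
  apply: contraNT => not_edge; rewrite mcoeff_sum big1 // => -[u v] /= uv.
  apply/eqP; apply: contraNT not_edge => /mcoeffM_neq0[a [b [-> _]]].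
  rewrite -mpolyXD mcoeffX; case: (_ =P b) => [<- _|_]; last by rewrite eqxx.
  by apply/in_edgeP; exists u, v; rewrite !mnmDE !mnm1E !eqxx !addnS !addn0.
rewrite (mpolyE f); elim/big_ind: _ => [||m _]; first exact: edge_ideal0.
  exact: edge_idealD.
have [->|/supp_f/in_edgeP[u [v [uv mu mv]]]] := eqVneq f@_m 0.
  by rewrite scale0r; apply: edge_ideal0.
have le_m : (U_(u) + U_(v) <= m)%MM.
  apply/mnm_lepP => i; rewrite mnmDE !mnm1E.
  case: (eqVneq u i) uv mu => [->|_ _ _]; last by case: eqP => // <-.
  by case: (eqVneq v i) => [->|//]; rewrite no_loop.
rewrite -mul_mpolyC; apply: edge_idealM.
rewrite -(submK le_m) mpolyXD; apply: edge_idealM; rewrite mpolyXD.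
exists (fun e => (e == (u, v))%:R).
rewrite (bigD1 (u, v)) //= eqxx mul1r big1 ?addr0 // => e /andP[_ /negbTE ->].
by rewrite mul0r.
Qed.

(** The ideal generated by the variables in [C]. *)
Definition var_ideal C f : Prop :=
  forall m, f@_m != 0 -> exists2 i, i \in C & (0 < m i)%N.

Lemma ideal_var_ideal C : ideal (var_ideal C).
Proof.
split=> [m|f g If Ig m|f g Ig m]; first by rewrite mcoeff0 eqxx.
  rewrite mcoeffD; have [->|/If//] := eqVneq f@_m 0.
  by rewrite add0r => /Ig.
case/mcoeffM_neq0=> a [b [-> _ /Ig[i iC bi]]].
by exists i; rewrite // mnmDE ltn_addl.
Qed.

(** Killing the variables in [C] has kernel [var_ideal C] and takes values in
    a domain. *)
Lemma prime_var_ideal C : prime_ideal (var_ideal C).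
Proof.
pose kill f : S := f \mPo [tuple if i \in C then 0 else 'X_i | i < n].
have killX m : kill 'X_[m] = if [forall i in C, m i == 0%N] then 'X_[m] else 0.
  rewrite /kill comp_mpolyX; case: ifP => [/forall_inP m0|/negP].
    rewrite [RHS]mpolyXE_id; apply: eq_bigr => i _; rewrite tnth_mktuple.
    by case: ifP => // /m0/eqP ->; rewrite !expr0.
  move/negP; rewrite negb_forall_in => /exists_inP[i iC mi].
  by rewrite (bigD1 i) //= tnth_mktuple iC expr0n (negbTE mi) mul0r.
have kill_coef f m :
    (kill f)@_m = if [forall i in C, m i == 0%N] then f@_m else 0.
  (* [kill] keeps the monomials that avoid [C] and drops the others. *)
  have -> : kill f = mfilter (fun m => [forall i in C, m i == 0%N]) f.
    rewrite {1}(mpolyE f) /kill raddf_sum /= /mfilter [RHS]big_mkcond.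
    apply: eq_bigr => m' _; rewrite comp_mpolyZ -/(kill _) killX.
    by case: ifP => // _; rewrite scaler0.
  by rewrite mcoeff_mfilter.
have killP f : var_ideal C f <-> kill f = 0.
  split=> [Cf|kf0 m fm].
    apply/mpolyP => m; rewrite kill_coef mcoeff0; case: forall_inP => // m0.
    apply/eqP/negPn/negP => /Cf[i /m0/eqP ->].
    by rewrite ltnn.
  have := kill_coef f m; rewrite kf0 mcoeff0; case: ifP => [_ /esym/eqP|].
    by rewrite (negbTE fm).
  move/negbT; rewrite negb_forall_in => /exists_inP[i iC mi] _.
  by exists i => //; rewrite lt0n.
split; first exact: ideal_var_ideal.
  case/(_ 0%MM) => [|i _]; last by rewrite mnm0E.
  by rewrite mcoeff1 eqxx oner_neq0.
move=> f g /killP; rewrite /kill rmorphM => /eqP.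
by rewrite mulf_eq0 => /orP[] /eqP kf0; [left | right]; apply/killP.
Qed.

(** If [D] and the complement of [N(D)] are both stable, then an edge inside
    the support of a monomial times the product of [D] must use a vertex of
    [N(D)] from the monomial. *)
Lemma colon_mset D f : stable G D -> stable G (~: nbh_set G D) ->
  colon I 'X_[mset D] f <-> var_ideal (nbh_set G D) f.
Proof.
move=> stD stN.
have in_edgeD m : in_edge (m + mset D)%MM <->
    exists2 i, i \in nbh_set G D & (0 < m i)%N.
  split=> [/in_edgeP[u [v [uv]]]|[i iN mi]].
    rewrite !mnmDE !msetE.
    wlog uN : u v uv / u \in nbh_set G D => [IH|].
      have [uN|uN] := boolP (u \in nbh_set G D); first exact: IH uN.
      have [vN mu mv|vN] := boolP (v \in nbh_set G D).
        by apply: (IH v u) => //; rewrite adj_sym.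
      move/forall_inP/(_ u): stN; rewrite inE uN => /(_ isT)/forall_inP/(_ v).
      by rewrite inE vN uv => /(_ isT).
    move=> mu _; exists u => //; move: mu.
    suff -> : u \in D = false by rewrite addn0.
    apply/negbTE/negP => uD; case/bigcupP: uN => d dD; rewrite inE => du.
    by move/forall_inP/(_ d dD)/forall_inP/(_ u uD): stD; rewrite du.
  case/bigcupP: iN => d dD; rewrite inE => di; apply/in_edgeP; exists d, i.
  by rewrite !mnmDE !msetE dD addn1; split=> //; rewrite ltn_addr.
rewrite /colon edge_idealP; split=> [If m fm|Nf m].
  by apply/in_edgeD/If; rewrite addmC mcoeffMX.
case/mcoeffM_neq0=> a [b [-> /Nf/in_edgeD]]; rewrite mcoeffX.
by case: (_ =P b) => [<-|]; rewrite ?eqxx.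
Qed.

Lemma v_attained_stable D : stable G D -> stable G (~: nbh_set G D) ->
  v_attained I #|D|.
Proof.
move=> stD stN; exists 'X_[mset D], (var_ideal (nbh_set G D)).
split; last by move=> g; apply: colon_mset.
  by rewrite dhomogX; apply/eqP; apply: mdeg_mset.
split; first exact: prime_var_ideal.
by exists 'X_[mset D] => g; apply: iff_sym; apply: colon_mset.
Qed.

End MonomialIdeals.

(** * The Koszul cycle of an induced matching *)

Section InducedMatchingCycle.

Import GRing.Theory.
Local Open Scope ring_scope.

Variables (K : fieldType) (n : nat) (G : sgraph n) (mate : 'I_n -> 'I_n).
Local Notation S := {mpoly K[n]}.
Local Notation I := (edge_ideal K G).
Implicit Types (T : {set 'I_n}) (c v : {set 'I_n} -> S).

(** A matching is encoded by the involution [mate] that exchanges the two ends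
    of each of its edges and fixes all other vertices. *)
Definition matched : {set 'I_n} := [set u | mate u != u].

Hypothesis mateK : involutive mate.
Hypothesis adj_matched : {in matched &, forall u w, adj G u w = (w == mate u)}.

Lemma mate_matched u : (mate u \in matched) = (u \in matched).
Proof. by rewrite !inE mateK eq_sym. Qed.

Definition edge_rank (u : 'I_n) : nat := minn u (mate u).

Lemma edge_rank_mate u : edge_rank (mate u) = edge_rank u.
Proof. by rewrite /edge_rank mateK minnC. Qed.

Lemma edge_rank_eq u w : edge_rank u = edge_rank w -> w = u \/ w = mate u.
Proof.
have rankP x : edge_rank x = x \/ edge_rank x = mate x.
  by rewrite /edge_rank /minn; case: ifP; auto.
case: (rankP u) (rankP w) => -> [] -> /val_inj.
- by move=> ->; left.
- by move=> ->; rewrite mateK; right.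
- by move=> <-; right.
by move/(inv_inj mateK) => ->; left.
Qed.

(** An order in which the two ends of each matching edge are consecutive, so
    that exchanging them in a transversal flips exactly one Koszul sign. *)
Definition edge_order (u w : 'I_n) : bool :=
  (edge_rank u < edge_rank w)%N ||
  ((edge_rank u == edge_rank w) && (u < w)%N).

Lemma edge_order_asym u w : u != w -> edge_order u w = ~~ edge_order w u.
Proof.
by rewrite -val_eqE /edge_order /=; case: ltngtP => //= _; case: ltngtP.
Qed.

Lemma edge_order_mate u w :
  u != w -> u != mate w -> edge_order u (mate w) = edge_order u w.
Proof.
move=> uw umw; rewrite /edge_order edge_rank_mate.
case: eqP => [/esym/edge_rank_eq[]|] // eq_u; first by rewrite eq_u eqxx in uw.
by rewrite eq_u eqxx in umw.
Qed.

Definition transversal T : bool :=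
  (T \subset matched) && [forall u in matched, (mate u \in T) == (u \notin T)].

Lemma transversalP T u :
  transversal T -> u \in matched -> (mate u \in T) = (u \notin T).
Proof. by case/andP=> _ /forall_inP trT /trT/eqP. Qed.

(** The functional that detects the Koszul cycle: it reads off the part of a
    chain whose multidegree is the product of all the matched vertices and
    whose exterior monomial takes one end of each edge. *)
Definition transversal_sum c : K :=
  \sum_(T | transversal T) (c T)@_(mset (matched :\: T)).

Lemma transversal_sumB c v :
  transversal_sum (fun T => c T - v T) = transversal_sum c - transversal_sum v.
Proof. by rewrite -sumrB; apply: eq_bigr => T _; rewrite mcoeffB. Qed.

(** The complement of a transversal is a transversal, hence stable. *)
Lemma transversal_sum_ideal c : (forall T, I (c T)) -> transversal_sum c = 0.
Proof.
move=> Ic; apply: big1 => T trT; apply/eqP.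
apply/negPn/negP => /(proj1 (edge_idealP G (c T)) (Ic T))/in_edgeP[u [w [uw]]].
rewrite !msetE !lt0b !inE => /andP[uT mu] /andP[wT mw].
move: uw; rewrite adj_matched ?inE // => /eqP def_w.
by move: wT; rewrite def_w (transversalP trT) ?inE // uT.
Qed.

(** Trading [j], which lies outside the transversal, for its mate: an
    involution without fixed points on the pairs below, which index the terms
    of [transversal_sum] of a boundary. *)
Definition exchange (p : {set 'I_n} * 'I_n) : {set 'I_n} * 'I_n :=
  ((p.2 |: p.1) :\ mate p.2, mate p.2).

Definition flag (p : {set 'I_n} * 'I_n) : bool :=
  transversal p.1 && (p.2 \in matched :\: p.1).

Lemma flagE T j : flag (T, j) ->
  [/\ transversal T, j \notin T, j \in matched, mate j \in T & mate j != j].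
Proof.
case/andP=> trT; rewrite /= inE => /andP[jT jM].
by split=> //; rewrite ?(transversalP trT) //; move: jM; rewrite inE.
Qed.

Lemma exchangeK p : flag p -> exchange (exchange p) = p.
Proof.
case: p => T j /flagE[trT jT jM mjT mjj]; rewrite /exchange /= mateK.
rewrite setD1K ?setU1K //.
by rewrite setU1r.
Qed.

Lemma flag_exchange p : flag p -> flag (exchange p).
Proof.
case: p => T j /flagE[trT jT jM mjT mjj]; rewrite /flag /exchange /=.
rewrite !inE eqxx mateK (eq_sym j) mjj /= andbT; apply/andP; split.
  apply/subsetP => u; rewrite in_setD1 in_setU1 => /andP[_ /orP[/eqP->//|]].
  by case/andP: trT => /subsetP sTM _ /sTM.
apply/forall_inP => u uM; rewrite !in_setD1 !in_setU1.
rewrite (inj_eq (inv_inj mateK)) (transversalP trT uM).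
have [->|uj] := eqVneq u j; first by rewrite (eq_sym j) mjj.
have [->|umj] := eqVneq u (mate j); first by rewrite mateK eqxx.
by rewrite -[mate u == j](inj_eq (inv_inj mateK)) mateK (negbTE umj).
Qed.

(** The vertices of [T] other than [mate j] compare in the same way with [j]
    and with [mate j], so only the comparison between these two changes. *)
Lemma ksign_exchange T j : flag (T, j) ->
  ksign K edge_order (mate j) ((j |: T) :\ mate j) = - ksign K edge_order j T.
Proof.
case/flagE=> trT jT jM mjT mjj.
have -> : (j |: T) :\ mate j = j |: (T :\ mate j).
  apply/setP => i; rewrite !inE; case: (eqVneq i j) => [->|//].
  by rewrite eq_sym mjj.
rewrite -{2}(setD1K mjT) !ksignU1 ?setD11 //; last by rewrite !inE (negbTE jT) andbF.
have -> : ksign K edge_order (mate j) (T :\ mate j)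
          = ksign K edge_order j (T :\ mate j).
  rewrite /ksign; congr (@GRing.exp S (-1) _); apply: eq_card => i; rewrite !inE.
  have [//|imj /=] := eqVneq i (mate j); have [iT /=|//] := boolP (i \in T).
  by apply: edge_order_mate => //; apply: contraNneq jT => <-.
rewrite (edge_order_asym mjj); case: (edge_order j _);
  rewrite /= ?expr0 ?expr1; ring.
Qed.

(** The terms indexed by [(T, j)] and by its exchange involve the same
    coefficient of [v], at [j |: T], with opposite signs. *)
Lemma transversal_sum_koszul v :
  transversal_sum (koszul edge_order v) = 0.
Proof.
pose f (p : {set 'I_n} * 'I_n) : K :=
  (ksign K edge_order p.2 p.1 * v (p.2 |: p.1))@_(mset (matched :\: (p.2 |: p.1))).
have fN p : flag p -> f (exchange p) = - f p.
  case: p => T j Tj; rewrite /f /exchange /= ksign_exchange //.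
  case/flagE: Tj => _ _ _ mjT _; rewrite setD1K ?setU1r //.
  by rewrite mulNr mcoeffN.
transitivity (\sum_(p | flag p) f p).
  rewrite -(pair_big_dep transversal (fun T j => j \in matched :\: T)
                         (fun T j => f (T, j))) /=.
  apply: eq_bigr => T _; rewrite mcoeff_sum [LHS]big_mkcond [RHS]big_mkcond.
  apply: eq_bigr => j _; rewrite !inE; case: ifP => //= jT.
  rewrite mulrCA mcoeffXM mnm1_le msetE !inE jT lt0b /=.
  case: ifP => // mj; rewrite mset_D1 ?inE ?jT //= /f /=.
  by rewrite setDDl setUC.
(* One term of each cancelling pair has [p.2 < mate p.2]. *)
rewrite (bigID (fun p : {set 'I_n} * 'I_n => (p.2 < mate p.2)%N)) /=.
rewrite [X in _ + X](reindex_onto exchange exchange) => [|p /andP[Tp _]]; last first.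
  exact: exchangeK.
rewrite [X in _ + X](eq_bigl (fun p => flag p && (p.2 < mate p.2)%N)) => [|p].
  rewrite [X in _ + X](eq_bigr (fun p => - f p)) => [|p /andP[Tp _]].
    by rewrite sumrN subrr.
  exact: fN.
apply/idP/idP => [/andP[/andP[Tp lep] /eqP eqp]|/andP[Tp ltp]].
  have flag_p : flag p by rewrite -eqp; apply: flag_exchange.
  rewrite flag_p; case/andP: flag_p => _; rewrite in_setD inE => /andP[_ ne].
  move: lep; rewrite /= mateK -leqNgt leq_eqVlt val_eqE eq_sym (negbTE ne).
  by [].
rewrite flag_exchange // exchangeK // eqxx andbT /= mateK -leqNgt ltnW //.
Qed.

Definition lower_ends : {set 'I_n} := [set u : 'I_n | (u < mate u)%N].

Lemma transversal_lower_ends : transversal lower_ends.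
Proof.
apply/andP; split; first by apply/subsetP => u; rewrite !inE neq_ltn orbC => ->.
apply/forall_inP => u; rewrite !inE mateK -val_eqE /=.
by case: ltngtP.
Qed.

Lemma card_upper_ends : #|matched :\: lower_ends| = #|lower_ends|.
Proof.
rewrite -(card_imset lower_ends (inv_inj mateK)); apply: eq_card => u.
apply/idP/imsetP => [|[w wB ->]].
  rewrite in_setD => /andP[uB uM]; exists (mate u); rewrite ?mateK //.
  by rewrite (transversalP transversal_lower_ends).
have wM : w \in matched.
  by move: wB; rewrite !inE => ltw; rewrite neq_ltn ltw orbT.
by rewrite in_setD mate_matched wM (transversalP transversal_lower_ends) ?wB.
Qed.

(** The product over the edges [{a, b}], with [a] the larger end, of ['X_a]
    times the exterior generator of [b]. *)
Definition matching_cycle T : S :=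
  if T == lower_ends then 'X_[mset (matched :\: lower_ends)] else 0.

(** The boundary replaces an exterior generator [b] by ['X_b], which completes
    the edge [{a, b}] in the monomial. *)
Lemma matching_cycle_boundary T : I (koszul edge_order matching_cycle T).
Proof.
rewrite /koszul; elim/big_ind: _ => [||j jT]; first exact: edge_ideal0.
  exact: edge_idealD.
apply: edge_idealM; rewrite /matching_cycle; case: eqP => [def_B|_]; last first.
  by rewrite mulr0; apply: edge_ideal0.
have jB : j \in lower_ends by rewrite -def_B setU11.
have jM : j \in matched.
  by move: jB; rewrite !inE => ltj; rewrite neq_ltn ltj orbT.
apply/edge_idealP => m; rewrite -mpolyXD mcoeffX.
case: (_ =P m) => [<- _|]; last by rewrite eqxx.
apply/in_edgeP; exists j, (mate j); split.
- by rewrite adj_matched ?mate_matched // eqxx.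
- by rewrite mnmDE mnm1E eqxx.
rewrite mnmDE msetE in_setD mate_matched jM.
by rewrite (transversalP transversal_lower_ends) // jB addn1.
Qed.

Lemma matching_cycle_not_boundary v :
  ~ (forall T, I (matching_cycle T - koszul edge_order v T)).
Proof.
move/transversal_sum_ideal; rewrite transversal_sumB transversal_sum_koszul subr0.
rewrite /transversal_sum (bigD1 lower_ends) ?transversal_lower_ends //=.
rewrite /matching_cycle eqxx mcoeffX eqxx big1 => [|T /andP[_ /negbTE ->]].
  by rewrite addr0; apply/eqP; rewrite oner_neq0.
by rewrite mcoeff0.
Qed.

End InducedMatchingCycle.

Section MatchingMate.

Variables (n : nat) (G : sgraph n) (P : {set {set 'I_n}}).
Hypothesis indP : induced_matching G P.

Definition matching_mate (u : 'I_n) : 'I_n :=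
  odflt u [pick w | (w != u) && ([set u; w] \in P)].

Lemma mem_edgesP (u w : 'I_n) : reflect (adj G u w) ([set u; w] \in edges G).
Proof.
rewrite inE; apply: (iffP existsP) => [[a /existsP[b /andP[ab /eqP eq_uw]]]|uw].
  have: (u \in [set a; b]) && (w \in [set a; b]) by rewrite -eq_uw !inE !eqxx orbT.
  have: (a \in [set u; w]) && (b \in [set u; w]) by rewrite eq_uw !inE !eqxx orbT.
  rewrite !inE => /andP[/orP[]/eqP ea /orP[]/eqP eb] _;
    by move: ab; rewrite ea eb ?no_loop // adj_sym.
by exists u; apply/existsP; exists w; rewrite uw eqxx.
Qed.

Lemma matching_edge e : e \in P -> e \in edges G.
Proof. by case/andP: indP => /andP[/subsetP sPE _] _; apply: sPE. Qed.

Lemma matching_mateE u w : [set u; w] \in P -> matching_mate u = w.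
Proof.
move=> uwP; have wu : w != u.
  have /mem_edgesP := matching_edge uwP.
  by apply: contraTneq => ->; rewrite no_loop.
rewrite /matching_mate; case: pickP => [w' /andP[w'u uw'P]|/(_ w)]; last first.
  by rewrite wu uwP.
case/andP: indP => /andP[_ trP] _ /=.
have uIn x : u \in [set u; x] by rewrite !inE eqxx.
have := def_pblock trP uwP (uIn w); rewrite (def_pblock trP uw'P (uIn w')).
by move/setP/(_ w'); rewrite !inE (negbTE w'u) eqxx => /esym/eqP.
Qed.

Lemma matching_mate_edge u :
  u \in matched matching_mate -> [set u; matching_mate u] \in P.
Proof.
by rewrite inE /matching_mate; case: pickP => [w /andP[]|] //=; rewrite eqxx.
Qed.

Lemma matching_mateK : involutive matching_mate.
Proof.
move=> u; have [uM|] := boolP (u \in matched matching_mate); last first.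
  by rewrite inE => /negPn/eqP eq_u; rewrite !eq_u.
by apply: matching_mateE; rewrite setUC; apply: matching_mate_edge.
Qed.

(** Where the matching being induced is used: an edge between matched vertices
    belongs to it. *)
Lemma adj_matching_mate : {in matched matching_mate &, forall u w,
  adj G u w = (w == matching_mate u)}.
Proof.
move=> u w uM wM; apply/idP/eqP => [uw|->]; last first.
  by apply/mem_edgesP/matching_edge/matching_mate_edge.
apply/esym/matching_mateE; case/andP: indP => _ /forall_inP indP'.
have /mem_edgesP/indP'/implyP := uw; apply.
have covered x : x \in matched matching_mate -> x \in cover P.
  move=> xM; apply/bigcupP; exists [set x; matching_mate x].
    exact: matching_mate_edge.
  by rewrite !inE eqxx.
by apply/subsetP => x; rewrite !inE => /orP[] /eqP ->; apply: covered.
Qed.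

Lemma card_lower_ends : #|lower_ends matching_mate| = #|P|.
Proof.
pose edge u := [set u; matching_mate u].
have <- : edge @: lower_ends matching_mate = P.
  apply/setP => e; apply/imsetP/idP => [[u uB ->]|eP].
    apply: matching_mate_edge; move: uB; rewrite !inE => ltu.
    by rewrite neq_ltn ltu orbT.
  have:= matching_edge eP; rewrite inE.
  case/existsP=> a /existsP[b /andP[ab /eqP def_e]].
  have ma : matching_mate a = b by apply: matching_mateE; rewrite -def_e.
  have mb : matching_mate b = a by rewrite -ma matching_mateK.
  have [ltab|leba] := ltnP a b.
    by exists a; rewrite ?inE ?ma // /edge ma.
  exists b; last by rewrite /edge mb setUC.
  rewrite inE mb ltn_neqAle leba andbT; apply/eqP => /val_inj eq_ab.
  by rewrite eq_ab no_loop in ab.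
rewrite card_in_imset // => u w; rewrite !inE => ltu ltw eq_uw.
have: u \in edge w by rewrite -eq_uw !inE eqxx.
rewrite !inE => /orP[/eqP //|/eqP def_u].
by move: ltu; rewrite def_u matching_mateK ltnNge (ltnW ltw).
Qed.

End MatchingMate.

(** * Comparing the Koszul complex with a minimal resolution *)

Section ZigZag.

Import GRing.Theory.
Local Open Scope ring_scope.

Variables (K : fieldType) (n : nat) (lt : rel 'I_n).
Local Notation S := {mpoly K[n]}.
Local Notation kos := (@koszul K n lt).
Hypothesis lt_asym : forall i j, i != j -> lt i j = ~~ lt j i.
Implicit Types (T U : {set 'I_n}).

(** The Koszul differential with coefficients in a free module, entry by
    entry. *)
Definition koszul_row k (w : {set 'I_n} -> 'rV[S]_k) T : 'rV[S]_k :=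
  \row_l kos (fun U => w U 0 l) T.

Lemma koszul_row_mulmx k k' (w : {set 'I_n} -> 'rV[S]_k) (A : 'M[S]_(k, k')) T :
  koszul_row w T *m A = koszul_row (fun U => w U *m A) T.
Proof.
apply/rowP => l; rewrite !mxE.
transitivity (kos (fun U => \sum_i w U 0 i * A i l) T).
  by rewrite koszul_sumM; apply: eq_bigr => i _; rewrite mxE.
by apply: eq_koszul => U; rewrite mxE.
Qed.

Lemma koszul_row_koszul_row k (w : {set 'I_n} -> 'rV[S]_k) T :
  koszul_row (koszul_row w) T = 0.
Proof.
apply/rowP => l; rewrite !mxE -[RHS](koszul_koszul lt_asym (fun U => w U 0 l) T).
by apply: eq_koszul => U; rewrite mxE.
Qed.

Lemma koszul_row_exact k (w w' : {set 'I_n} -> 'rV[S]_k) :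
  (forall T, koszul_row w T = koszul_row w' T) ->
  (forall l, (w set0 0 l)@_0 = 0) -> (forall l, (w' set0 0 l)@_0 = 0) ->
  exists v, forall T, w T - w' T = koszul_row v T.
Proof.
move=> eq_ww' w0 w'0.
have exact_l (l : 'I_k) :
    exists v, forall T, w T 0 l - w' T 0 l = kos v T.
  apply: koszul_exact => // [T|]; last by rewrite mcoeffB w0 w'0 subrr.
  move/rowP/(_ l): (eq_ww' T); rewrite !mxE koszulB => ->.
  exact: subrr.
have [v def_v] := fin_all_exists exact_l.
exists (fun T => \row_l v l T) => T; apply/rowP => l; rewrite !mxE def_v.
by apply: eq_koszul => U; rewrite mxE.
Qed.

Lemma homogeneousC (a : K) : homogeneous 0 (a%:MP : S).
Proof.
move=> m; rewrite mcoeffC; have [->|_] := eqVneq m 0%MM; first by rewrite mdeg0.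
by rewrite mulr0 eqxx.
Qed.

Lemma homogeneous_koszul (d : int) (c : {set 'I_n} -> S) T :
  (forall U, homogeneous (d - #|U|%:Z) (c U)) -> homogeneous (d - #|T|%:Z) (kos c T).
Proof.
move=> hc; apply: homogeneous_sum => j jT.
have -> : d - #|T|%:Z = 0 + (1 + (d - #|j |: T|%:Z)) by rewrite cardsU1 jT; lia.
apply: homogeneousM; last first.
  apply: homogeneousM; last exact: hc.
  by have := @homogeneousX K n U_(j); rewrite mdeg1.
have -> : ksign K lt j T = ((-1) ^+ #|[set i in T | lt i j]|)%:MP.
  by rewrite rmorph_sign.
exact: homogeneousC.
Qed.

Variable I : S -> Prop.
Hypothesis idealI : ideal I.
Hypothesis gradedI : forall d f, I f -> I (hcomp d f).
Variable F : graded_resolution I.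
Hypothesis minF : minimal F.

(** The kernel of the map out of [F_i], which goes to [S/I] when [i = 0]. *)
Definition cycles (i : nat) : 'rV[S]_(rk F i) -> Prop :=
  match i with
  | 0 => fun u => I ((u *m aug F) 0 0)
  | i'.+1 => fun u => u *m diff F i' = 0
  end.

Lemma cyclesP i (u : 'rV[S]_(rk F i)) :
  cycles u <-> exists w, u = w *m diff F i.
Proof. by case: i u => [|i] u; [apply: aug_exact | apply: diff_exact]. Qed.

Lemma cycles0 i : cycles (0 : 'rV[S]_(rk F i)).
Proof. by apply/cyclesP; exists 0; rewrite mul0mx. Qed.

(** Minimality: cycles are boundaries, whose entries lie in the ideal of the
    variables. *)
Lemma cycles_mcoeff0 i (u : 'rV[S]_(rk F i)) l : cycles u -> (u 0 l)@_0 = 0.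
Proof.
case/cyclesP=> w ->; rewrite mxE mcoeff_sum big1 // => k _.
by rewrite rmorphM /= minF mulr0.
Qed.

Lemma homogeneous_diff i k l : homogeneous (shift k - shift l) (diff F i k l).
Proof. by move=> m; rewrite -mcoeff_msupp => /diff_homog <-; rewrite addrK. Qed.

Lemma homogeneous_aug k : homogeneous (shift k) (aug F k 0).
Proof. by move=> m; rewrite -mcoeff_msupp => /aug_homog. Qed.

Variable d : int.

Definition row_homogeneous i (e : int) (u : 'rV[S]_(rk F i)) : Prop :=
  forall l, homogeneous (e - shift l) (u 0 l).

Lemma homogeneous_lift i e (u : 'rV[S]_(rk F i)) :
  cycles u -> row_homogeneous e u ->
  exists w, [/\ u = w *m diff F i, row_homogeneous e w & u = 0 -> w = 0].
Proof.
case: (eqVneq u 0) => [-> _ _|u_neq0].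
  exists 0; split=> // [|l]; first by rewrite mul0mx.
  by rewrite mxE; apply: homogeneous0.
case/cyclesP=> w def_u hu; exists (\row_l hcomp (e - shift l) (w 0 l)).
split=> [|l|u0]; last by rewrite u0 eqxx in u_neq0.
  apply/rowP => l; rewrite -(hcomp_id (hu l)) def_u !mxE hcomp_sum.
  apply: eq_bigr => k _; rewrite (hcompM _ _ (@homogeneous_diff i k l)) !mxE.
  by congr (hcomp _ _ * _); ring.
by rewrite mxE; apply: homogeneous_hcomp.
Qed.

(** A Koszul chain with values in [F_i] whose boundary is a cycle for [F] that
    is not the boundary of a chain of cycles of [F]. The total degree is [d],
    and the vanishing condition bounds the exterior degree by [m - i]. *)
Definition obstruction (m i : nat) (w : {set 'I_n} -> 'rV[S]_(rk F i)) : Prop :=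
  [/\ forall T, row_homogeneous (d - #|T|%:Z) (w T),
      forall T, (m < #|T| + i)%N -> w T = 0,
      forall T, cycles (koszul_row w T)
    & forall w', (forall T, cycles (w' T)) ->
        ~ (forall T, koszul_row w T = koszul_row w' T)].

Lemma homogeneous_koszul_row i (w : {set 'I_n} -> 'rV[S]_(rk F i)) T :
  (forall U, row_homogeneous (d - #|U|%:Z) (w U)) ->
  row_homogeneous (d - #|T|%:Z) (koszul_row w T).
Proof.
move=> hw l; rewrite mxE addrAC; apply: homogeneous_koszul => U.
by rewrite addrAC; apply: hw.
Qed.

(** Lift the Koszul boundary of [w] along [F_(i+1) -> F_i] to [w1]. If [w1] had
    the same boundary as a chain [w'] of cycles, then, all constants being
    zero, [w1 - w'] would be a Koszul boundary, and applying the differential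
    of [F] would bound the boundary of [w] within the cycles. A nonzero
    constant in [w1] would sit at a generator of degree [d]. *)
Lemma obstruction_lift m i (w : {set 'I_n} -> 'rV[S]_(rk F i)) :
  (forall k : 'I_(rk F i.+1), shift k <> d) ->
  obstruction m w -> exists w', @obstruction m i.+1 w'.
Proof.
move=> no_d [hw sw cw nw].
have lift_w T := homogeneous_lift (cw T) (@homogeneous_koszul_row i w T hw).
have [w1 /all_and3[def_w1 hw1 w1_0]] := fin_all_exists lift_w.
have dw1 T : koszul_row w1 T *m diff F i = 0.
  rewrite koszul_row_mulmx -[RHS](koszul_row_koszul_row w T).
  by apply/rowP => l; rewrite !mxE; apply: eq_koszul => U; rewrite def_w1.
exists w1; split=> // [T Tm|w' cw' eq_w'].
  apply: w1_0; apply/rowP => l; rewrite !mxE /koszul big1 // => j jT.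
  by rewrite sw ?mxE ?mulr0 // cardsU1 jT add1n addSnnS.
have [||v def_v] := koszul_row_exact eq_w'.
- move=> l; apply/eqP/negPn/negP => /hw1; rewrite cards0 mdeg0 subr0 => /esym/eqP.
  by rewrite subr_eq0 => /eqP/esym; apply: no_d.
- by move=> l; apply: cycles_mcoeff0.
apply: (nw (fun T => v T *m diff F i)) => T.
  by apply/cyclesP; exists (v T).
by rewrite -koszul_row_mulmx -def_v mulmxBl cw' subr0.
Qed.

(** The same argument along [F_0 -> S/I]: the class of [z] is lifted by
    multiplying it with a degree 0 preimage [u] of [1]. *)
Lemma obstruction_start m (z : {set 'I_n} -> S) :
  (forall k : 'I_(rk F 0), shift k <> d) ->
  (forall T, I (kos z T)) -> (forall v, ~ (forall T, I (z T - kos v T))) ->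
  (forall T, homogeneous (d - #|T|%:Z) (z T)) ->
  (forall T, (m < #|T|)%N -> z T = 0) ->
  exists w, @obstruction m 0 w.
Proof.
move=> no_d cz nz hz sz; have [I0 ID IM] := idealI.
have [u0 Iu0] := aug_surj F.
pose u : 'rV[S]_(rk F 0) := \row_l hcomp (- shift l) (u0 0 l).
have Iu : I ((u *m aug F) 0 0 - 1).
  suff -> : (u *m aug F) 0 0 - 1 = hcomp 0 ((u0 *m aug F) 0 0 - 1).
    exact: gradedI.
  rewrite hcompB (@hcomp_id _ _ 0 1) -?mpolyC1; last exact: homogeneousC.
  congr (_ - _); rewrite !mxE hcomp_sum; apply: eq_bigr => k _.
  by rewrite (hcompM _ _ (@homogeneous_aug k)) mxE sub0r.
have hu l : homogeneous (- shift l) (u 0 l).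
  by rewrite mxE; apply: homogeneous_hcomp.
pose w T : 'rV[S]_(rk F 0) := z T *: u.
have hw T : row_homogeneous (d - #|T|%:Z) (w T).
  by move=> l; rewrite mxE; apply: homogeneousM.
have dw T : koszul_row w T = kos z T *: u.
  apply/rowP => l; rewrite !mxE /koszul mulr_suml; apply: eq_bigr => j _.
  by rewrite !mxE !mulrA.
exists w; split=> // [T Tm|T|w' cw' eq_w'].
- by rewrite /w sz ?scale0r // -[X in (_ < X)%N]addn0.
- by rewrite dw /cycles -scalemxAl mxE mulrC; apply: IM.
have [||v def_v] := koszul_row_exact eq_w'.
- move=> l; apply/eqP/negPn/negP => /hw; rewrite cards0 mdeg0 subr0 => /esym/eqP.
  by rewrite subr_eq0 => /eqP/esym; apply: no_d.
- by move=> l; apply: cycles_mcoeff0.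
apply: (nz (fun T => (v T *m aug F) 0 0)) => T.
have -> : kos (fun U => (v U *m aug F) 0 0) T
          = z T * (u *m aug F) 0 0 - (w' T *m aug F) 0 0.
  transitivity ((koszul_row v T *m aug F) 0 0).
    by rewrite koszul_row_mulmx mxE.
  by rewrite -def_v mulmxBl -scalemxAl !mxE.
set a := (u *m aug F) 0 0 in Iu *; set b := (w' T *m aug F) 0 0.
have -> : z T - (z T * a - b) = (- z T) * (a - 1) + b by ring.
by apply: ID; [apply: IM | apply: cw'].
Qed.

(** The balancing of Tor: a nonzero Koszul homology class of [S/I], in
    homological degree at most [m] and internal degree [d], is carried by the
    zigzag between the Koszul complex and [F] to a generator of degree [d]. *)
Lemma koszul_cycle_betti m (z : {set 'I_n} -> S) :
  (forall T, I (kos z T)) -> (forall v, ~ (forall T, I (z T - kos v T))) ->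
  (forall T, homogeneous (d - #|T|%:Z) (z T)) ->
  (forall T, (m < #|T|)%N -> z T = 0) ->
  exists2 i, (i <= m)%N & betti F i d <> 0%N.
Proof.
move=> cz nz hz sz.
have [/existsP[i bi]|no_betti] := boolP [exists i : 'I_m.+1, betti F i d != 0%N].
  by exists i; [rewrite -ltnS | apply/eqP].
have no_d i : (i <= m)%N -> forall k : 'I_(rk F i), shift k <> d.
  move=> im k /eqP kd; case/existsP: no_betti; exists (Ordinal (n:=m.+1) (m:=i) im).
  by rewrite -lt0n; apply/card_gt0P; exists k; rewrite inE.
have obs i : (i <= m)%N -> exists w, @obstruction m i w.
  elim: i => [|i IHi] im; first by apply: (obstruction_start (no_d 0%N im) cz).
  have [w ow] := IHi (ltnW im).
  exact: obstruction_lift (no_d _ im) ow.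
(* At [i = m] the chain is supported on the empty set, so its boundary is 0. *)
have [w [_ sw _ nw]] := obs m (leqnn m).
case: (nw (fun _ => 0)) => [T|T]; first exact: cycles0.
apply/rowP => l; rewrite !mxE; transitivity (0 : S).
  apply: big1 => j jT.
  by rewrite sw ?mxE ?mulr0 // cardsU1 jT add1n addSn ltnS leq_addl.
by apply/esym/big1 => j _; rewrite !mulr0.
Qed.

End ZigZag.

(** * Induced matchings bound the regularity from below *)

Section RegularityBound.

Import GRing.Theory.
Local Open Scope ring_scope.

Variables (K : fieldType) (n : nat) (G : sgraph n).

Lemma edge_ideal_hcomp d (f : {mpoly K[n]}) :
  edge_ideal K G f -> edge_ideal K G (hcomp d f).
Proof.
move/edge_idealP=> If; apply/edge_idealP => m; rewrite mcoeff_mfilter.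
by case: ifP => _; [apply: If | rewrite eqxx].
Qed.

Lemma induced_matching_regularity (P : {set {set 'I_n}}) (reg : int) :
  induced_matching G P -> is_regularity (edge_ideal K G) reg ->
  (#|P|%:Z <= reg)%R.
Proof.
move=> indP [F [minF _ reg_max]].
pose mate := matching_mate P; pose B := lower_ends mate.
have mateK : involutive mate := matching_mateK indP.
have cardB : #|B| = #|P| := card_lower_ends indP.
have adj_mate := adj_matching_mate indP.
have [||||T|T|i im bi] := @koszul_cycle_betti K n _ (@edge_order_asym n mate) _ _ _ F
    minF (#|P| + #|P|)%N #|P| (@matching_cycle K n mate).
- by split; [apply: edge_ideal0|apply: edge_idealD|apply: edge_idealM].
- exact: edge_ideal_hcomp.
- exact: matching_cycle_boundary.
- exact: matching_cycle_not_boundary.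
- rewrite /matching_cycle; case: eqP => [->|_]; last exact: homogeneous0.
  rewrite cardB PoszD addrK -cardB -(card_upper_ends mateK) -mdeg_mset.
  exact: homogeneousX.
- by rewrite /matching_cycle; case: eqP => // ->; rewrite cardB ltnn.
have := reg_max i _ bi; lia.
Qed.

End RegularityBound.

(** * Stable sets in a graph partitioned by simplexes *)

Section StableSets.

Variables (s : nat) (G : sgraph s).
Implicit Types (u v w : 'I_s) (D : {set 'I_s}).

Lemma stableP D : reflect {in D &, forall u w, ~~ adj G u w} (stable G D).
Proof.
apply: (iffP forall_inP) => [stD u w uD wD|stD u uD].
  by move/forall_inP: (stD u uD); apply.
by apply/forall_inP => w; apply: stD.
Qed.

Lemma stable_adj D u w : stable G D -> u \in D -> w \in D -> adj G u w = false.
Proof. by move/stableP=> stD uD wD; apply/negbTE/stD. Qed.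

Lemma mem_nbh_set D u w : u \in D -> adj G u w -> w \in nbh_set G D.
Proof. by move=> uD uw; apply/bigcupP; exists u; rewrite // inE. Qed.

Lemma simplicialP x :
  simplicial G x -> {in cl_nbh G x &, forall u w, u != w -> adj G u w}.
Proof.
move/forall_inP=> complete_x u w ux wx uw; apply/mem_edgesP.
move/forall_inP/(_ w wx)/implyP/(_ uw): (complete_x u ux).
by rewrite inE => /andP[].
Qed.

(** [N(D)] is a cover since its complement is stable. It is minimal since each
    of its vertices has a neighbour in [D], which lies outside [N(D)]. *)
Lemma stable_min_coverP D : stable G D -> stable G (~: nbh_set G D) ->
  D \in stable_min_cover G.
Proof.
move=> stD stN; rewrite inE stD; apply/minsetP; split.
  apply/forall_inP => e; rewrite inE => /existsP[u /existsP[w /andP[uw /eqP ->]]].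
  apply/set0Pn; apply/existsP; apply: contraLR uw => /existsPn no_cover.
  rewrite (stable_adj stN) // inE.
    by apply: contra (no_cover u) => uN; rewrite !inE eqxx.
  by apply: contra (no_cover w) => wN; rewrite !inE eqxx orbT.
move=> C /forall_inP coverC CN; apply/eqP; rewrite eqEsubset CN.
apply/subsetP => w /bigcupP[u uD]; rewrite inE => uw.
have /mem_edgesP/coverC/set0Pn[v] := uw; rewrite !inE => /andP[/orP[]/eqP-> //].
move/(subsetP CN)/bigcupP=> [u' u'D]; rewrite inE.
by rewrite (stable_adj stD u'D uD).
Qed.

Variables (r : nat) (x : 'I_r -> 'I_s).
Hypothesis simplicial_x : forall i, simplicial G (x i).
Hypothesis cover_x : forall v, exists i, v \in cl_nbh G (x i).
Hypothesis disjoint_x : forall i i' v,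
  v \in cl_nbh G (x i) -> v \in cl_nbh G (x i') -> i = i'.

Lemma center_in i : x i \in cl_nbh G (x i).
Proof. by rewrite !inE eqxx. Qed.

(** A maximal stable set among the vertices other than the [x i]. Two adjacent
    vertices are not both of the form [x i], and by maximality one that is not
    either lies in [D] or is dominated by [D]. *)
Lemma exists_stable_avoiding :
  exists D, [/\ stable G D, stable G (~: nbh_set G D) & forall i, x i \notin D].
Proof.
pose avoid D := stable G D && [forall i, x i \notin D].
have avoid0 : avoid set0.
  apply/andP; split; first by apply/stableP => u w; rewrite inE.
  by apply/forallP => i; rewrite inE.
have [D /maxsetP[/andP[stD /forallP xD] maxD]] := ex_maxset (ex_intro avoid _ avoid0).
exists D; split=> //.
have max_in v : v \notin nbh_set G D -> (forall i, v != x i) -> v \in D.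
  move=> vN vx; rewrite -(maxD (v |: D)) ?setU11 ?subsetU1 //; apply/andP; split.
    have no_adj u : u \in D -> adj G u v = false.
      by move=> uD; apply: contraNF vN; apply: mem_nbh_set.
    apply/stableP => u w; rewrite !inE => /orP[/eqP->|uD] /orP[/eqP->|wD].
    - by rewrite no_loop.
    - by rewrite adj_sym no_adj.
    - by rewrite no_adj.
    by rewrite (stable_adj stD).
  by apply/forallP => i; rewrite !inE negb_or eq_sym vx xD.
apply/stableP => u w; rewrite !inE => uN wN; apply/negP => uw.
have [/existsP[i /eqP def_u]|/existsPn ux] := boolP [exists i, u == x i].
  have wD : w \in D.
    apply: max_in => // i'; apply/eqP => def_w.
    have ii' : i = i'.
      by apply: (disjoint_x _ (center_in i')); rewrite -def_w -def_u !inE uw orbT.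
    by rewrite def_u def_w ii' no_loop in uw.
  by case/negP: uN; apply: (mem_nbh_set wD); rewrite adj_sym.
by case/negP: wN; apply: mem_nbh_set uw; apply: max_in.
Qed.

Lemma enum_val_ltn (A : {set 'I_r}) (i i' : 'I_#|A|) :
  (i < i')%N -> (enum_val i < enum_val i')%N.
Proof.
move=> lt_ii'; have x0 := enum_val i.
have sortA : sorted ltn [seq val k | k <- enum A].
  apply: (subseq_sorted ltn_trans _ (iota_ltn_sorted 0 r)).
  by rewrite -val_enum_ord map_subseq // enumT filter_subseq.
have := sorted_ltn_nth ltn_trans 0%N sortA.
move/(_ i i'); rewrite !inE size_map -cardE !ltn_ord => /(_ isT isT lt_ii').
by rewrite !(nth_map x0) -?cardE // -!enum_val_nth.
Qed.

Variable D : {set 'I_s}.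
Hypothesis stable_D : stable G D.
Hypothesis x_notin_D : forall i, x i \notin D.

Definition met_simplexes : {set 'I_r} :=
  [set i | [exists y, (y \in D) && (y \in cl_nbh G (x i))]].

Local Notation k := #|met_simplexes|.
Local Notation j := (@enum_val _ met_simplexes).

Lemma exists_representatives : exists y : 'I_k -> 'I_s,
  forall i, y i \in D /\ y i \in cl_nbh G (x (j i)).
Proof.
have ex_y (i : 'I_k) : exists y, y \in D /\ y \in cl_nbh G (x (j i)).
  have := enum_valP i; rewrite inE => /existsP[y /andP[yD yx]].
  by exists y.
have [y y_in] := fin_all_exists ex_y.
by exists y.
Qed.

Variable y : 'I_k -> 'I_s.
Hypothesis y_in : forall i, y i \in D /\ y i \in cl_nbh G (x (j i)).

Lemma representatives_inj : injective y.
Proof.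
move=> i i' eq_y; apply/enum_val_inj/disjoint_x; first exact: (y_in i).2.
by rewrite eq_y; apply: (y_in i').2.
Qed.

(** Two vertices of the stable set [D] in one simplex would be adjacent. *)
Lemma representatives_image : D = [set y i | i : 'I_k].
Proof.
apply/setP => v; apply/idP/imsetP => [vD|[i _ ->]]; last by case: (y_in i).
have [i vx] := cover_x v.
have iJ : i \in met_simplexes by rewrite inE; apply/existsP; exists v; rewrite vD.
exists (enum_rank_in iJ i) => //; case: (y_in (enum_rank_in iJ i)).
rewrite enum_rankK_in // => yD yx; apply/eqP; apply: contraT => ne.
by rewrite -(stable_adj stable_D vD yD); apply: (simplicialP (simplicial_x i)).
Qed.

Definition simplex_matching : {set {set 'I_s}} :=
  [set [set x (j i); y i] | i : 'I_k].

Lemma adj_xy i : adj G (x (j i)) (y i).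
Proof.
have [yD] := y_in i; rewrite !inE => /orP[/eqP y_x|//].
by case/negP: (x_notin_D (j i)); rewrite -y_x.
Qed.

Lemma xy_in_simplex i v :
  v \in [set x (j i); y i] -> v \in cl_nbh G (x (j i)).
Proof.
rewrite in_set2 => /orP[] /eqP ->; first exact: center_in.
exact: (y_in i).2.
Qed.

Lemma simplex_index i i' v : v \in cl_nbh G (x (j i)) ->
  v \in cl_nbh G (x (j i')) -> i = i'.
Proof. by move=> vi vi'; apply/enum_val_inj/(disjoint_x vi). Qed.

(** The neighbours of [x (j i)] all lie in its own simplex and the [y i] are
    pairwise non-adjacent, so no edge joins two of the pairs. *)
Lemma induced_simplex_matching : induced_matching G simplex_matching.
Proof.
apply/andP; split; first (apply/andP; split).
- by apply/subsetP => e /imsetP[i _ ->]; apply/mem_edgesP/adj_xy.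
- apply/trivIsetP => _ _ /imsetP[i _ ->] /imsetP[i' _ ->] ne_e.
  rewrite -setI_eq0; apply: contraNT ne_e => /set0Pn[v /setIP[vi vi']].
  by rewrite (simplex_index (xy_in_simplex vi) (xy_in_simplex vi')).
apply/forall_inP => e; rewrite inE => /existsP[u /existsP[w /andP[uw /eqP ->]]].
apply/implyP => /subsetP sub.
have /bigcupP[_ /imsetP[i _ ->] ui] := sub u (set21 u w).
have /bigcupP[_ /imsetP[i' _ ->] wi'] := sub w (set22 u w).
have same_simplex v i1 i2 :
    adj G (x (j i1)) v -> v \in [set x (j i2); y i2] -> i1 = i2.
  move=> xv /xy_in_simplex; apply: simplex_index.
  by rewrite !inE xv orbT.
have [eq_i|ne_i] := eqVneq i i'.
  apply/imsetP; exists i => //; rewrite -eq_i in wi'.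
  move: ui wi' uw; rewrite !in_set2.
  by do 2 case/orP=> /eqP->; rewrite ?no_loop // setUC.
case/eqP: ne_i; move: ui; rewrite in_set2 => /orP[/eqP def_u|/eqP def_u].
  by apply: same_simplex wi'; rewrite -def_u.
move: wi'; rewrite in_set2 => /orP[/eqP def_w|/eqP def_w].
  apply/esym/(same_simplex u); first by rewrite -def_w adj_sym.
  by rewrite def_u set22.
have := stable_adj stable_D (y_in i).1 (y_in i').1.
by rewrite -def_u -def_w uw.
Qed.

Lemma card_simplex_matching : #|simplex_matching| = k.
Proof.
rewrite card_imset ?card_ord // => i i' eq_e; apply: (simplex_index (center_in _)).
by apply: xy_in_simplex; rewrite -eq_e set21.
Qed.

End StableSets.

(** Used for [v_attained], a predicate that is not evidently decidable, hence
    by excluded middle. *)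
Lemma exists_least (Q : nat -> Prop) d :
  Q d -> exists2 v, Q v /\ (forall e, Q e -> (v <= e)%N) & (v <= d)%N.
Proof.
elim/ltn_ind: d => d IHd Qd.
have [[e lt_ed Qe]|min_d] := classic (exists2 e, (e < d)%N & Q e).
  have [v min_v le_ve] := IHd e lt_ed Qe.
  by exists v; rewrite // (leq_trans le_ve) // ltnW.
exists d => //; split=> // e Qe; rewrite leqNgt; apply/negP => lt_ed.
by apply: min_d; exists e.
Qed.

Lemma exists_maximum_induced_matching s (G : sgraph s) :
  exists2 P, induced_matching G P & im G = #|P|.
Proof.
have ind0 : induced_matching G set0.
  apply/andP; split.
    by rewrite /matching sub0set; apply/trivIsetP => A B; rewrite inE.
  apply/forall_inP => e; rewrite inE => /existsP[u /existsP[w /andP[_ /eqP ->]]].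
  rewrite /cover big_set0 subset0; apply/implyP => /eqP/setP/(_ u).
  by rewrite !inE eqxx.
have [|P indP max_P] := @eq_bigmax_cond _ (induced_matching G) (fun P => #|P|).
  by apply/card_gt0P; exists set0.
by exists P; rewrite // -max_P; apply: eq_bigl.
Qed.

Theorem theorem4p9 (K : fieldType) (s : nat) (G : sgraph s)
    (r : nat) (H : 'I_r -> subgraph s)
    (simplexH : forall i, is_simplex G (H i))
    (distinctH : injective (fun i => vertices (H i)))
    (partitionH : partition [set vertices (H i) | i : 'I_r] [set: 'I_s])
    (no_isolated : forall v, ~~ isolated G v) :
  exists (D : {set 'I_s}) (k : nat) (x y : 'I_k -> 'I_s) (j : 'I_k -> 'I_r)
         (P : {set {set 'I_s}}),
    [/\ D = [set y i | i : 'I_k] /\ injective y,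
        D \in stable_min_cover G,
        P = [set [set x i; y i] | i : 'I_k] /\ induced_matching G P,
        (forall i, simplicial G (x i)) /\
        (forall i i' : 'I_k, (i < i')%N -> (j i < j i')%N) /\
        (forall i, H (j i) = induced G (cl_nbh G (x i)))
      & [/\ exists2 v, is_vnumber (edge_ideal K G) v & (v <= #|D|)%N,
            #|D| = #|P|,
            (#|P| <= im G)%N
          & forall reg : int, is_regularity (edge_ideal K G) reg ->
              ((im G)%:Z <= reg)%R]].
Proof.
have [x simplicial_x def_H] := fin_all_exists2 simplexH.
have vertH i : vertices (H i) = cl_nbh G (x i) by rewrite def_H.
have cover_x v : exists i, v \in cl_nbh G (x i).
  have: v \in cover [set vertices (H i) | i : 'I_r].
    by rewrite (cover_partition partitionH) inE.
  by case/bigcupP=> _ /imsetP[i _ ->] vi; exists i; rewrite -vertH.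
have disjoint_x i i' v : v \in cl_nbh G (x i) -> v \in cl_nbh G (x i') -> i = i'.
  rewrite -!vertH => vi vi'; apply: distinctH.
  have trivH := partition_trivIset partitionH.
  rewrite -(def_pblock trivH _ vi) ?imset_f //.
  by rewrite -(def_pblock trivH _ vi') ?imset_f.
have [D [stD stN xD]] := exists_stable_avoiding disjoint_x.
have [y y_in] := exists_representatives G x D.
have def_D := representatives_image simplicial_x cover_x stD y_in.
have y_injective := representatives_inj disjoint_x y_in.
have indP := induced_simplex_matching disjoint_x stD xD y_in.
have cardP := card_simplex_matching disjoint_x y_in.
exists D, #|met_simplexes G x D|, (fun i => x (enum_val i)), y,
  (fun i => enum_val i), (simplex_matching y).
split=> //.
- exact: stable_min_coverP.
- split=> [i|]; first exact: simplicial_x.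
  by split=> [i i'|i]; [apply: enum_val_ltn | apply: def_H].
split.
- exact/exists_least/v_attained_stable.
- by rewrite cardP {1}def_D card_imset // card_ord.
- exact: (leq_bigmax_cond (F := fun P : {set {set 'I_s}} => #|P|)).
move=> reg is_reg; have [P indP' ->] := exists_maximum_induced_matching G.
exact: induced_matching_regularity indP' is_reg.
Qed.
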